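(* Let $1\le p\le 2$, let $\{e_n\}_{n\in\mathbb{N}}$ be the unit vector basis of the real space $\ell_p$ and let $\{e_n^*\}_{n\in\mathbb{N}}\subset \ell_p^*$ be its biorthogonal (coordinate) functionals. Then $\{e_n,e_n^*\}_{n\in\mathbb{N}}$ is an unconditional Hilbert-Schauder basis of $\ell_p$.
   Context: All Banach spaces are over the real scalars. For a separable Banach space $X$, a Schauder basis $\{z_n\}$ of $X$ with biorthogonal functionals $\{z_n^*\}\subset X^*$ (written $\{z_n,z_n^*\}$) is called a Hilbert-Schauder basis (HS-basis) if there is a bounded linear operator $S:X\to X^*$ with $S(z_n)=z_n^*$ for all $n$. It is an unconditional Hilbert-Schauder basis if moreover the basis $\{z_n\}$ is unconditional. *)

(* Defs.v *)
From HB Require Import structures.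
From mathcomp Require Import all_boot all_order all_algebra.
From mathcomp Require Import all_classical all_reals all_analysis.

Set Implicit Arguments.
Unset Strict Implicit.
Unset Printing Implicit Defensive.

Import Order.TTheory GRing.Theory Num.Theory.
Import numFieldNormedType.Exports.

Local Open Scope classical_set_scope.
Local Open Scope ring_scope.

(* The topological dual of a normed space: bounded linear functionals with the
   operator norm. *)
Section dual.
Context {R : realType} (X : normedModType R).

Definition bounded_functional : {pred X -> R} :=
  mem [set f : X -> R | linear f /\ bounded_near f (nbhs (0 : X))].

Lemma bounded_functionalP (f : X -> R) : f \in bounded_functional <->
  linear f /\ exists M : R, forall x, `|f x| <= M * `|x|.
Proof.
rewrite inE /=; split=> [[lf bf]|[lf [M fM]]].
  split=> //.
  pose L := GRing.isLinear.Build R X R _ f lf.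
  pose g : {linear X -> R} := HB.pack f L.
  have /pinfty_ex_gt0[M _ gM] := (linear_boundedP g).1 bf.
  by exists M.
split=> //.
pose L := GRing.isLinear.Build R X R _ f lf.
pose g : {linear X -> R} := HB.pack f L.
apply: (linear_boundedP g).2; near=> r => x.
apply: (le_trans (fM x)); apply: ler_wpM2r => //.
Unshelve. all: by end_near. Qed.

Lemma bounded_functional_submod_closed : submod_closed bounded_functional.
Proof.
split.
  apply/bounded_functionalP; split=> [a x y|].
    by rewrite /= /GRing.zero/= scaler0 addr0.
  by exists 0 => x; rewrite normr0 mul0r.
move=> a f g /bounded_functionalP[lf [M fM]] /bounded_functionalP[lg [N gN]].
apply/bounded_functionalP; split=> [b x y|].
  rewrite !fctE lf lg !scalerDr !scalerA (mulrC a b).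
  by rewrite addrACA.
exists (`|a| * M + N) => x; rewrite !fctE (le_trans (ler_normD _ _))// mulrDl.
by rewrite lerD// normrZ -mulrA ler_wpM2l.
Qed.

HB.instance Definition _ := GRing.isSubmodClosed.Build R (X -> R)
  bounded_functional bounded_functional_submod_closed.

Record dual := Dual { dual_fun :> X -> R;
  dual_mem : dual_fun \in bounded_functional }.

HB.instance Definition _ := [isSub for dual_fun].
HB.instance Definition _ := [Choice of dual by <:].
HB.instance Definition _ := [SubChoice_isSubLmodule of dual by <:].

Definition dual_norm (f : dual) : R :=
  sup [set `|f x| | x in [set x : X | `|x| <= 1]].

Lemma dual_linear (f : dual) : linear (f : X -> R).
Proof. by have /bounded_functionalP[] := dual_mem f. Qed.

Lemma dual_norm_ball (f : dual) x : `|x| <= 1 -> `|f x| <= dual_norm f.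
Proof.
have /bounded_functionalP[_ [M fM]] := dual_mem f.
move=> x1; apply: sup_upper_bound; last by exists x.
split; first by exists `|f 0|, 0 => //=; rewrite normr0.
exists `|M| => _ [y /= y1 <-]; rewrite (le_trans (fM y))//.
rewrite (le_trans (ler_wpM2r _ (ler_norm M)))//.
by rewrite -[leRHS]mulr1 ler_wpM2l.
Qed.

Lemma dual_norm_le (f : dual) (M : R) :
  (forall x, `|x| <= 1 -> `|f x| <= M) -> dual_norm f <= M.
Proof.
move=> fM; apply: ge_sup; first by exists `|f 0|, 0 => //=; rewrite normr0.
by move=> _ [y /= y1 <-]; exact: fM.
Qed.

Lemma dual_normP (f : dual) x : `|f x| <= dual_norm f * `|x|.
Proof.
pose L := GRing.isLinear.Build R X R _ f (dual_linear f).
pose g : {linear X -> R} := HB.pack (f : X -> R) L.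
have [->|x0] := eqVneq x 0.
  by rewrite -[f 0]/(g 0) linear0 !normr0 mulr0.
have nx0 : 0 < `|x| by rewrite normr_gt0.
rewrite -ler_pdivrMr//.
rewrite (_ : _ / _ = `|f (`|x|^-1 *: x)|); last first.
  by rewrite -![f _]/(g _) linearZ/= normrM normfV normr_id mulrC.
by apply: dual_norm_ball; rewrite normrZ normfV normr_id mulVf ?gt_eqF.
Qed.

Lemma dual_normD (f g : dual) : dual_norm (f + g) <= dual_norm f + dual_norm g.
Proof.
apply: dual_norm_le => x x1; rewrite (le_trans (ler_normD _ _))//.
by rewrite lerD// dual_norm_ball.
Qed.

Lemma dual_normZ (a : R) (f : dual) : dual_norm (a *: f) = `|a| * dual_norm f.
Proof.
have le b (g : dual) : dual_norm (b *: g) <= `|b| * dual_norm g.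
  by apply: dual_norm_le => x x1; rewrite normrM ler_wpM2l// dual_norm_ball.
apply/eqP; rewrite eq_le le/=.
have [->|a0] := eqVneq a 0.
  rewrite normr0 mul0r (le_trans _ (dual_norm_ball _ (x := 0) _))//.
  by rewrite normr0.
rewrite -ler_pdivlMl ?normr_gt0// -normfV (le_trans _ (le _ _))//.
by rewrite scalerA mulVf// scale1r.
Qed.

Lemma dual_norm0_eq0 (f : dual) : dual_norm f = 0 -> f = 0.
Proof.
move=> f0; apply/val_inj/funext => x /=.
by have := dual_normP f x; rewrite f0 mul0r normr_le0 => /eqP.
Qed.

HB.instance Definition _ := Lmodule_isNormed.Build R dual
  dual_normD dual_normZ dual_norm0_eq0.

End dual.

(* Every function on nat is measurable, so LfunType over the counting measure
   consists of all real sequences x with sum_k |x k|^p finite; equality is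
   pointwise, and 'N[counting]_p is the usual l_p norm (see lp_normE). *)
Section lp.
Context {R : realType} {p : R} (p1 : 1 <= p).

Definition lp : Type := LfunType (@counting nat R) (p1 : (1 <= p%:E)%E).

HB.instance Definition _ := GRing.Lmodule.on lp.

Let p0 : 0 < p. Proof. exact: lt_le_trans p1. Qed.

Lemma lpE (a : R) (x y : lp) n : (a *: x + y : lp) n = a * x n + y n.
Proof. by []. Qed.

Definition lp_norm (x : lp) : R := fine 'N[counting]_p%:E[EFin \o x].

Lemma Lnorm_counting_leP (u : nat -> R) (r : R) : 0 <= r ->
  ('N[counting]_p%:E[EFin \o u] <= r%:E)%E <->
  forall n, \sum_(k < n) `|u k| `^ p <= r `^ p.
Proof.
move=> r0; rewrite Lnorm_counting//.
have u0 k : (0 <= k)%N -> true -> (0 <= `|(u k)%:E| `^ p)%E by rewrite poweR_ge0.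
have S0 := nneseries_ge0 u0.
have partE n : (\sum_(0 <= k < n) `|(u k)%:E| `^ p)%E =
    (\sum_(k < n) `|u k| `^ p)%:E.
  by rewrite big_mkord -sumEFin; apply: eq_bigr => k _; rewrite poweR_EFin.
set S := (\sum_(0 <= k <oo) _)%E in S0 *.
have -> : (S `^ p^-1 <= r%:E)%E <-> (S <= (r `^ p)%:E)%E.
  split=> h.
    rewrite -poweR_EFin -[S]poweRe1// -(@mulVf _ p) ?gt_eqF// poweRrM.
    apply: gt0_ler_poweR h; first exact: ltW p0.
      by rewrite in_itv/= leey poweR_ge0.
    by rewrite in_itv/= leey lee_fin r0.
  rewrite -[r]powRr1// -(@mulfV _ p) ?gt_eqF// powRrM -poweR_EFin.
  apply: gt0_ler_poweR h; first by rewrite invr_ge0 ltW.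
    by rewrite in_itv/= leey S0.
  by rewrite in_itv/= leey lee_fin powR_ge0.
split=> [h n|h].
  rewrite -lee_fin -partE (le_trans _ h)//.
  exact: nneseries_lim_ge.
apply: lime_le; first exact: is_cvg_nneseries.
by apply: nearW => n; rewrite partE lee_fin.
Qed.

Lemma lp_norm_leP (x : lp) (r : R) : 0 <= r ->
  lp_norm x <= r <-> forall n, \sum_(k < n) `|x k| `^ p <= r `^ p.
Proof.
move=> r0; rewrite -Lnorm_counting_leP// -(finite_norm_fine (x : LfunType _ _)).
by rewrite lee_fin.
Qed.

Lemma lp_norm_ge0 (x : lp) : 0 <= lp_norm x.
Proof. by apply: fine_ge0; exact: Lnorm_ge0. Qed.

Lemma lp_sum_le (x : lp) n : \sum_(k < n) `|x k| `^ p <= lp_norm x `^ p.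
Proof. exact: (lp_norm_leP x (lp_norm_ge0 x)).1. Qed.

Lemma powRK_le (a b : R) : 0 <= a -> 0 <= b -> a `^ p <= b `^ p -> a <= b.
Proof.
move=> a0 b0; apply: contraTT; rewrite -!ltNge => ba.
exact: gt0_ltr_powR.
Qed.

Lemma lp_coord_le (x : lp) n : `|x n| <= lp_norm x.
Proof.
apply: powRK_le => //; first exact: lp_norm_ge0.
apply: le_trans (lp_sum_le x n.+1); rewrite big_ord_recr/=.
by rewrite lerDr sumr_ge0// => k _; exact: powR_ge0.
Qed.

Lemma lp_normD (x y : lp) : lp_norm (x + y) <= lp_norm x + lp_norm y.
Proof. exact: (ler_LnormD (x : LfunType _ _) (y : LfunType _ _)). Qed.

Lemma lp_normZ (a : R) (x : lp) : lp_norm (a *: x) = `|a| * lp_norm x.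
Proof.
apply: EFin_inj; rewrite EFinM (finite_norm_fine (x : LfunType _ _)).
rewrite (finite_norm_fine (a *: x : LfunType _ _)).
exact: (LnormZ (x : LfunType _ _)).
Qed.

Lemma lp_norm0_eq0 (x : lp) : lp_norm x = 0 -> x = 0.
Proof.
move=> x0; apply/LfuneqP => n; apply/eqP; rewrite -normr_le0 -x0.
exact: lp_coord_le.
Qed.

HB.instance Definition _ := Lmodule_isNormed.Build R lp
  lp_normD lp_normZ lp_norm0_eq0.

Lemma lp_mem (u : nat -> R) (r : R) : 0 <= r ->
  (forall n, \sum_(k < n) `|u k| `^ p <= r `^ p) ->
  u \in Lfun (@counting nat R) p%:E.
Proof.
move=> r0 /Lnorm_counting_leP-/(_ r0) ur.
apply/andP; rewrite !inE/=; split; first by move=> _ Y _.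
exact: le_lt_trans ur (ltry _).
Qed.

Definition lp_seq (u : nat -> R) (uP : u \in Lfun (@counting nat R) p%:E) : lp :=
  Lfun_Sub (p1 : (1 <= p%:E)%E) uP.

Lemma unit_vector_sum_le i n :
  \sum_(k < n) `|(k == i :> nat)%:R : R| `^ p <= 1 `^ p.
Proof.
rewrite powR1; have [ni|ni] := leqP n i.
  rewrite big1// => k _; rewrite ltn_eqF ?normr0 ?powR0 ?gt_eqF//.
  exact: leq_trans ni.
rewrite (bigD1 (Ordinal ni))//= eqxx normr1 powR1 big1 ?addr0// => k.
by rewrite -val_eqE/= => /negbTE->; rewrite normr0 powR0 ?gt_eqF.
Qed.

Lemma unit_vector_mem i :
  (fun n => (n == i)%:R) \in Lfun (@counting nat R) p%:E.
Proof. exact: (lp_mem ler01 (unit_vector_sum_le i)). Qed.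

Definition unit_vector (i : nat) : lp := lp_seq (unit_vector_mem i).

Lemma unit_vectorE i n : unit_vector i n = (n == i)%:R.
Proof. by []. Qed.

Lemma norm_unit_vector_le1 i : `|unit_vector i| <= 1.
Proof. by apply/lp_norm_leP => // n; exact: unit_vector_sum_le. Qed.

Lemma coordinate_bounded n :
  (fun x : lp => x n) \in bounded_functional (X := lp).
Proof.
apply/bounded_functionalP; split=> //.
by exists 1 => x; rewrite mul1r; exact: lp_coord_le.
Qed.

Definition coordinate_functional (n : nat) : dual lp := Dual (coordinate_bounded n).

Lemma lp_normE (x : lp) :
  (`|x|%:E = (\sum_(0 <= k <oo) (`|x k| `^ p)%:E) `^ p^-1)%E.
Proof.
have -> : (`|x|%:E = 'N[counting]_p%:E[EFin \o x])%E.
  exact: (finite_norm_fine (x : LfunType _ _)).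
by rewrite Lnorm_counting//; under eq_eseriesr do rewrite poweR_EFin.
Qed.

Definition lp_trunc (u : nat -> R) (n : nat) : lp :=
  \sum_(k < n) u k *: unit_vector k.

Lemma lp_truncE u n i : lp_trunc u n i = if (i < n)%N then u i else 0.
Proof.
rewrite /lp_trunc; elim: n => [|n ih]; first by rewrite big_ord0.
rewrite big_ord_recr/= -[LHS]/((\sum_(k < n) _ : lp) i + u n * (i == n)%:R).
rewrite ih ltnS; have [ni|ni|->] := ltngtP i n.
- by rewrite mulr0 addr0.
- by rewrite mulr0 addr0.
- by rewrite mulr1 add0r.
Qed.

Lemma lp_trunc_sum (u : nat -> R) n :
  \sum_(k < n) `|u k| `^ p = \sum_(k < n) `|lp_trunc u n k| `^ p.
Proof. by apply: eq_bigr => k _; rewrite lp_truncE ltn_ord. Qed.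

Lemma lp_trunc_leP (u : nat -> R) n (r : R) : 0 <= r ->
  `|lp_trunc u n| <= r <-> \sum_(k < n) `|u k| `^ p <= r `^ p.
Proof.
move=> r0; split=> [ur|ur].
  by rewrite lp_trunc_sum; exact: (lp_norm_leP _ r0).1.
apply/lp_norm_leP => // m; apply: le_trans ur; rewrite (lp_trunc_sum u).
rewrite -!(big_mkord xpredT (fun k => `|lp_trunc u n k| `^ p)).
have [nm|mn] := leqP n m.
  rewrite (big_cat_nat _ nm)//= [X in _ + X]big_nat [X in _ + X]big1 ?addr0// => k.
  by case/andP => nk _; rewrite lp_truncE ltnNge nk normr0 powR0// gt_eqF.
rewrite [leRHS](big_cat_nat _ (ltnW mn))//= lerDl sumr_ge0//.
Qed.

Lemma lp_complete (F : set_system lp) : ProperFilter F -> cauchy F -> cvg F.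
Proof.
move=> FF /cauchy_ballP cF.
have coordE (x y : lp) n : `|x n - y n| <= `|x - y|.
  exact: (lp_coord_le (x - y)).
have /choice[l lP] n : exists c : R, ((x : lp) n : R) @[x --> F] --> c.
  suff : cauchy (((x : lp) n : R) @[x --> F]) by move/cauchy_cvgP/cvg_ex.
  apply: cauchy_exP => e e0.
  have /cauchy_ballP/cauchyP/(_ e e0)[x xF] := cF.
  exists (x n).
  suff : \forall y \near F, ball (x n) e ((y : lp) n) by [].
  apply: (@filterS _ F _ _ _ _ xF) => y.
  by rewrite -!ball_normE/=; exact: le_lt_trans.
have trunc_close e : 0 < e ->
    \forall x \near F, forall n, `|lp_trunc (fun k => (x : lp) k - l k) n| <= e.
  move=> e0; have e20 : 0 < e / 2 by rewrite divr_gt0.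
  have /nearP_dep := cF _ e20; apply: filterS => x xF n.
  have yl : \forall y \near F, forall k : 'I_n,
      `|l k - (y : lp) k| <= e / 2 / n.+1%:R.
    apply: filter_forall => k.
    have /cvgrPdist_le := lP k; apply.
    by rewrite divr_gt0.
  near F => y.
  have -> : lp_trunc (fun k => x k - l k) n =
      lp_trunc (x - y) n + lp_trunc (fun k => y k - l k) n.
    rewrite -big_split; apply: eq_bigr => k _ /=.
    by rewrite -scalerDl addrA subrK.
  rewrite (le_trans (ler_normD _ _))// (splitr e) lerD//.
    apply/lp_trunc_leP; first exact: ltW.
    apply: (lp_norm_leP (x - y) _).1; first exact: ltW.
    have : ball x (e / 2) y by near: y.
    by rewrite -ball_normE/= => /ltW.
  rewrite (le_trans (ler_norm_sum _ _ _))//.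
  apply: (@le_trans _ _ (\sum_(k < n) e / 2 / n.+1%:R)).
    apply: ler_sum => k _; rewrite normrZ -[leRHS]mulr1.
    rewrite ler_pM ?norm_unit_vector_le1// distrC.
    have : forall k : 'I_n, `|l k - y k| <= e / 2 / n.+1%:R by near: y.
    exact.
  rewrite sumr_const card_ord -[_ *+ n]mulr_natr -(mulrA (e / 2)) ler_piMr ?ltW//.
  by rewrite mulrC ltr_pdivrMr// mul1r ltr_nat.
have close_sum e (x : lp) : 0 < e ->
    (forall n, `|lp_trunc (fun k => x k - l k) n| <= e) ->
    forall n, \sum_(k < n) `|x k - l k| `^ p <= e `^ p.
  by move=> e0 xl n; apply/(lp_trunc_leP (fun k => x k - l k)) => //; exact: ltW.
near F => x.
have /(close_sum _ _ ltr01) xl :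
    forall n, `|lp_trunc (fun k => x k - l k) n| <= 1.
  by near: x; exact: trunc_close.
pose L : lp := x - lp_seq (u := fun k => x k - l k) (lp_mem ler01 xl).
have LE k : L k = l k by rewrite -[LHS]/(x k - (x k - l k)) opprB addrC subrK.
apply/cvg_ex; exists L; apply/cvgrPdist_le => e e0.
have := trunc_close e e0; apply: filterS => y /(close_sum _ _ e0) yl.
rewrite distrC; apply/lp_norm_leP; first exact: ltW.
by move=> n; under eq_bigr do rewrite -[(y - L) _]/(y _ - L _) LE.
Unshelve. all: by end_near. Qed.

HB.instance Definition _ := Uniform_isComplete.Build lp lp_complete.

End lp.

Definition separable (T : topologicalType) :=
  exists2 A : set T, countable A & dense A.

Section bases.
Context {R : realType} {X : completeNormedModType R}.
Implicit Types (z : nat -> X) (zs : nat -> dual X).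

Definition schauder_basis z :=
  forall x : X, exists! a : nat -> R, series (fun n => a n *: z n) @ \oo --> x.

Definition unconditionally_convergent (u : nat -> X) :=
  forall s : nat -> nat, bijective s -> cvgn (series (u \o s)).

Definition unconditional_basis z :=
  schauder_basis z /\
  forall (x : X) (a : nat -> R), series (fun n => a n *: z n) @ \oo --> x ->
    unconditionally_convergent (fun n => a n *: z n).

Definition biorthogonal z zs := forall m n, zs m (z n) = (m == n)%:R.

Definition HS_basis z zs :=
  [/\ separable X, schauder_basis z, biorthogonal z zs &
      exists2 S : {linear X -> dual X},
        bounded_near S (nbhs (0 : X)) & forall n, S (z n) = zs n].

Definition unconditional_HS_basis z zs :=
  HS_basis z zs /\ unconditional_basis z.

End bases.

(* Main.v *)
(* Each rearranged partial sum of [x = sum_n x_n e_n] differs from [x] by [x]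
   with some coordinates erased, so once the first [N] coordinates are exhausted
   the error is at most the l_p tail of [x] beyond [N]; this gives the basis
   property and its unconditionality together.  The operator [S] is
   [x |-> (y |-> sum_k x_k y_k)]: for norm-one [x] and [y],
   [2 |x_k y_k| <= |x_k|^2 + |y_k|^2 <= |x_k|^p + |y_k|^p], where [p <= 2]
   enters through [|x_k| <= 1], so the pairing is bounded by [|x| |y|]. *)
Require Import Defs.
From HB Require Import structures.
From mathcomp Require Import all_boot all_order all_algebra.
From mathcomp Require Import all_classical all_reals all_analysis.
Import Order.TTheory GRing.Theory Num.Theory.
Import numFieldNormedType.Exports.
Local Open Scope ring_scope.

(** * Absolute convergence, and separability from a basis *)

Lemma series_bounded_cvgn {R : realType} (u : nat -> R) (M : R) :
  (forall n, \sum_(k < n) `|u k| <= M) -> cvgn (series u).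
Proof.
move=> uM; apply: normed_cvg; apply: nondecreasing_is_cvgn.
  by apply: nondecreasing_series => k _ _; exact: normr_ge0.
by exists M => _ [n _ <-]; rewrite [leLHS]big_mkord.
Qed.

(** Finite rational combinations of the [z k] are dense: truncate the expansion of a point of the
    open set, then round the coefficients. *)
Lemma schauder_basis_separable {R : realType} {X : completeNormedModType R}
  (z : nat -> X) : schauder_basis z -> separable X.
Proof.
move=> zb; pose q (s : seq rat) : X := \sum_(k < size s) ratr s`_k *: z k.
exists (range q)%classic.
  exact: sub_countable (card_image_le _ _) (countableP _).
move=> O [x Ox] Oo; have [a [ax _]] := zb x.
have /nbhs_ballP[e /= e0 eO] : nbhs x O by exact: open_nbhs_nbhs.
have e20 : 0 < e / 2 by rewrite divr_gt0.
have /cvgrPdist_lt/(_ _ e20)[n _ /(_ n (leqnn n))/= xn] := ax.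
(* With this tolerance each of the [n] terms moves by at most [e / 2 / n.+1], so rounding costs at
   most [e / 2]. Both [n.+1] and [1 + |z k|] are positive even if [n] or [z k] vanishes. *)
have /choice[r rP] k : exists r : rat,
    `|a k - ratr r| <= e / 2 / n.+1%:R / (1 + `|z k|).
  have d0 : 0 < e / 2 / n.+1%:R / (1 + `|z k|).
    by rewrite !divr_gt0// ltr_wpDr.
  have /rat_in_itvoo[r] : a k < a k + e / 2 / n.+1%:R / (1 + `|z k|).
    by rewrite ltrDl.
  rewrite in_itv/= => /andP[r1 r2]; exists r.
  by rewrite ler_distlC (ltW r2) (le_trans _ (ltW r1))// gerDl oppr_le0 ltW.
exists (q (mkseq r n)); split; last by exists (mkseq r n).
apply: eO; rewrite -ball_normE/= /q size_mkseq (splitr e).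
rewrite -(subrK (series (fun n => a n *: z n) n) x) -addrA.
rewrite (le_lt_trans (ler_normD _ _))// ltr_leD//.
rewrite /series/= big_mkord -sumrB (le_trans (ler_norm_sum _ _ _))//.
apply: (@le_trans _ _ (\sum_(k < n) e / 2 / n.+1%:R)).
  apply: ler_sum => k _; rewrite nth_mkseq// -scalerBl normrZ.
  have z0 : 0 < 1 + `|z k| by rewrite ltr_wpDr.
  rewrite (le_trans (ler_wpM2r (normr_ge0 _) (rP k)))// mulrAC ler_pdivrMr//.
  by rewrite ler_wpM2l ?lerDr// ltW ?divr_gt0.
rewrite sumr_const card_ord -[_ *+ n]mulr_natr -(mulrA (e / 2)) ler_piMr ?ltW//.
by rewrite mulrC ltr_pdivrMr// mul1r ltr_nat.
Qed.

(** * Unconditional expansion along the unit vectors *)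

Section lp.
Context {R : realType} {p : R} (p1 : 1 <= p).
Implicit Types x y : lp p1.

Let p0 : 0 < p. Proof. exact: lt_le_trans p1. Qed.

Lemma lp_subE x y i : (x - y) i = x i - y i.
Proof. by []. Qed.

Lemma lp_sumE (u : nat -> lp p1) (n i : nat) :
  (\sum_(k < n) u k) i = \sum_(k < n) u k i.
Proof.
elim: n => [|n ih]; first by rewrite !big_ord0.
by rewrite !big_ord_recr/= -ih.
Qed.

(** The p-th powers have bounded partial sums, hence form a Cauchy series. Finite blocks, uniform in
    [m], are what [lp_norm_leP] tests. *)
Lemma lp_tail x (e : R) : 0 < e ->
  exists N, forall m, \sum_(N <= k < m) `|x k| `^ p <= e `^ p.
Proof.
move=> e0.
have /cvg_cauchy/cauchy_seriesP : cvgn (series (fun k => `|x k| `^ p)).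
  apply: (@series_bounded_cvgn _ _ (lp_norm x `^ p)) => n.
  under eq_bigr do rewrite ger0_norm ?powR_ge0//.
  exact: lp_sum_le.
move=> /(_ _ (powR_gt0 p e0))[[A B] /= [[N1 _ NA] [N2 _ NB]] AB].
exists (maxn N1 N2) => m; have [mN|Nm] := leqP m (maxn N1 N2).
  by rewrite big_geq// powR_ge0.
apply/(le_trans (ler_norm _))/ltW/(AB (maxn N1 N2, m)); split=> /=.
  by apply: NA; rewrite /= leq_maxl.
by apply: NB; rewrite /= (leq_trans (leq_maxr N1 N2))// ltnW.
Qed.

Lemma lp_rearrangement_cvg x (s : nat -> nat) : bijective s ->
  (series ((fun n => x n *: unit_vector p1 n) \o s) @ \oo --> x)%classic.
Proof.
move=> [t st ts]; apply/cvgrPdist_le => e e0.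
have [N NP] := lp_tail x e e0.
(* Coordinate [i] enters the rearranged series at position [t i]; from this index on, all
   coordinates below [N] have entered. *)
exists (\max_(i < N) (t i).+1) => // n /= Nn.
pose d : lp p1 := x - series ((fun n => x n *: unit_vector p1 n) \o s) n.
have dE i : d i = if (t i < n)%N then 0 else x i.
  rewrite /d lp_subE /series/= big_mkord.
  rewrite (lp_sumE (fun k => x (s k) *: unit_vector p1 (s k))).
  rewrite (eq_bigr (fun k : 'I_n => if k == t i :> nat then x i else 0)).
    rewrite -big_mkcond/=; case: ifPn => [tn|tn].
      by rewrite (big_pred1 (Ordinal tn))/= ?subrr.
    rewrite big_pred0 ?subr0// => k.
    by apply/negbTE; apply: contra tn => /eqP <-.
  move=> k _; rewrite -[LHS]/(x (s k) * (i == s k)%:R).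
  rewrite -[i == _](can_eq ts) st eq_sym.
  case: eqP => [->|_]; last by rewrite mulr0.
  by rewrite ts mulr1.
suff : lp_norm d <= e by [].
apply/lp_norm_leP => [|m]; first exact: ltW.
apply: le_trans (NP m); rewrite -(big_mkord xpredT (fun k => `|_ k| `^ p)).
have lt_tN i : (i < N)%N -> (t i < n)%N.
  by move=> iN; apply: leq_trans Nn; exact: (leq_bigmax (Ordinal iN)).
have [mN|Nm] := leqP m N.
  rewrite [leRHS]big_geq// big_nat big1// => i /andP[_ im].
  by rewrite [X in `|X|]dE lt_tN ?(leq_trans im)// normr0 powR0 ?gt_eqF.
rewrite (big_cat_nat _ (ltnW Nm))//=.
rewrite [X in X + _]big_nat big1 ?add0r => [|i /andP[_ iN]].
  apply: ler_sum => i _; rewrite [X in `|X|]dE; case: ifP => // _.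
  by rewrite normr0 powR0 ?powR_ge0 ?gt_eqF.
by rewrite [X in `|X|]dE lt_tN// normr0 powR0 ?gt_eqF.
Qed.

(** Coordinates are continuous by [lp_coord_le], and coordinate [i] of a partial sum is [a i] once
    more than [i] terms are taken. *)
Lemma unit_vector_coef (a : nat -> R) x :
  (series (fun n => a n *: unit_vector p1 n) @ \oo --> x)%classic -> a = x.
Proof.
move=> ax; apply/funext => i; apply/eqP; rewrite eq_sym -subr_eq0 -normr_le0.
apply/ler_addgt0Pr => e e0; rewrite add0r.
have /cvgrPdist_le/(_ _ e0)[N _ NP] := ax.
have := NP (maxn N i.+1) (leq_maxl _ _); apply: le_trans.
apply: le_trans (lp_coord_le _ i).
rewrite lp_subE /series/= big_mkord.
by rewrite [X in _ <= `|_ - X|](lp_truncE p1) leq_maxr.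
Qed.

Lemma unit_vector_schauder : schauder_basis (unit_vector p1).
Proof.
move=> x; exists x; split; last by move=> a /unit_vector_coef.
by apply: (lp_rearrangement_cvg x id); exists id.
Qed.

Lemma unit_vector_unconditional : unconditional_basis (unit_vector p1).
Proof.
split=> [|x a /unit_vector_coef -> s sbij]; first exact: unit_vector_schauder.
by apply/cvg_ex; exists x; exact: lp_rearrangement_cvg.
Qed.

(** * The pairing and the operator into the dual *)

Hypothesis p2 : p <= 2.

Lemma sqr_le_powR (a : R) : 0 <= a <= 1 -> a ^+ 2 <= a `^ p.
Proof.
move=> /andP[]; rewrite le_eqVlt => /predU1P[<-|a0] a1.
  by rewrite expr0n powR_ge0.
by rewrite -(powR_mulrn 2 (ltW a0)); apply: ger_powR; rewrite ?a0.
Qed.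

Lemma lp_pairing_le1 x y n : `|x| <= 1 -> `|y| <= 1 ->
  \sum_(k < n) `|x k * y k| <= 1.
Proof.
move=> x1 y1.
have coord_le1 (z : lp p1) k : `|z| <= 1 -> 0 <= `|z k| <= 1.
  by move=> z1; rewrite normr_ge0 (le_trans (lp_coord_le z k)).
have sum_le1 (z : lp p1) : `|z| <= 1 -> \sum_(k < n) `|z k| `^ p <= 1.
  by move=> /lp_norm_leP -/(_ ler01 n); rewrite powR1.
apply: (@le_trans _ _ (\sum_(k < n) (`|x k| `^ p + `|y k| `^ p) / 2)).
  apply: ler_sum => k _; rewrite normrM ler_pdivlMr//.
  apply: le_trans (lerD (sqr_le_powR _ (coord_le1 x k x1))
    (sqr_le_powR _ (coord_le1 y k y1))).
  (* The difference of the two sides is the square of [|x k| - |y k|]. *)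
  by rewrite -subr_ge0 addrAC mulr_natr -sqrrB sqr_ge0.
by rewrite -mulr_suml big_split/= ler_pdivrMr// mul1r lerD ?sum_le1.
Qed.

(** By homogeneity, normalising both vectors reduces this to [lp_pairing_le1]; zero vectors are
    treated apart. *)
Lemma lp_pairing_le x y n : \sum_(k < n) `|x k * y k| <= `|x| * `|y|.
Proof.
have [->|x0] := eqVneq x 0.
  by rewrite big1 ?mulr_ge0// => k _; rewrite mul0r normr0.
have [->|y0] := eqVneq y 0.
  by rewrite big1 ?mulr_ge0// => k _; rewrite mulr0 normr0.
have nx : 0 < `|x| by rewrite normr_gt0.
have ny : 0 < `|y| by rewrite normr_gt0.
rewrite -[leRHS]mulr1 -ler_pdivrMl ?mulr_gt0// mulr_sumr.
have unit_norm (z : lp p1) : 0 < `|z| -> `|(`|z|^-1 *: z)| <= 1.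
  by move=> z0; rewrite normrZ normfV normr_id mulVf ?gt_eqF.
apply: le_trans (lp_pairing_le1 _ _ n (unit_norm x nx) (unit_norm y ny)).
apply: ler_sum => k _.
rewrite -[leRHS]/(`|(`|x|^-1 * x k) * (`|y|^-1 * y k)|).
rewrite mulrACA [leRHS]normrM invfM.
by rewrite [X in _ <= X * _]ger0_norm ?mulr_ge0 ?invr_ge0.
Qed.

Definition lp_pairing x y : R := limn (series (fun k => x k * y k)).

Lemma lp_pairing_cvg x y : cvgn (series (fun k => x k * y k)).
Proof. exact: series_bounded_cvgn (lp_pairing_le x y). Qed.

Lemma lp_pairing_linearl (a : R) x y z :
  lp_pairing (a *: x + y) z = a * lp_pairing x z + lp_pairing y z.
Proof.
rewrite /lp_pairing -[a * _]lim_seriesZ; last exact: lp_pairing_cvg.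
rewrite -lim_seriesD; last 2 first.
- exact/is_cvg_seriesZ/lp_pairing_cvg.
- exact: lp_pairing_cvg.
congr (limn (series _)); apply/funext => k.
by rewrite -[LHS]/((a * x k + y k) * z k) mulrDl -mulrA.
Qed.

(** Symmetry carries linearity over to the second argument, as membership in the dual requires. *)
Lemma lp_pairingC x y : lp_pairing x y = lp_pairing y x.
Proof.
by congr (limn (series _)); apply/funext => k; rewrite mulrC.
Qed.

Lemma norm_lp_pairing_le x y : `|lp_pairing x y| <= `|x| * `|y|.
Proof.
rewrite -lim_norm; last exact: lp_pairing_cvg.
apply: limr_le; first exact: is_cvg_norm (lp_pairing_cvg x y).
apply: nearW => n; apply: le_trans (lp_pairing_le x y n).
by rewrite /series/= big_mkord ler_norm_sum.
Qed.

Lemma lp_pairing_bounded x : lp_pairing x \in bounded_functional (X := lp p1).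
Proof.
apply/bounded_functionalP; split=> [a y z|].
  by rewrite !(lp_pairingC x) lp_pairing_linearl.
by exists `|x| => y; exact: norm_lp_pairing_le.
Qed.

Definition lp_to_dual x : dual (lp p1) := Dual (lp_pairing_bounded x).

Lemma lp_to_dual_linear : linear lp_to_dual.
Proof.
by move=> a x y; apply/val_inj/funext => z; exact: lp_pairing_linearl.
Qed.

HB.instance Definition _ := GRing.isLinear.Build R (lp p1) (dual (lp p1)) _
  lp_to_dual lp_to_dual_linear.

Lemma lp_to_dual_bounded : bounded_near lp_to_dual (nbhs (0 : lp p1)).
Proof.
apply/linear_boundedP; near=> r => x.
have /le_trans : `|lp_to_dual x| <= `|x|.
  apply: dual_norm_le => y y1; apply: (le_trans (norm_lp_pairing_le x y)).
  by rewrite ler_piMr.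
(* The operator norm of [lp_to_dual x] is at most [|x|], so every [r] at least 1 is a bound. *)
by apply; rewrite ler_peMl.
Unshelve. all: by end_near. Qed.

Lemma lp_to_dual_unit_vector n :
  lp_to_dual (unit_vector p1 n) = coordinate_functional p1 n.
Proof.
apply/val_inj/funext => y; rewrite /= /lp_pairing.
apply: lim_near_cst; first exact: Rhausdorff.
(* Partial sums of length at least [n.+1] contain the only nonzero term, [k = n], and so equal
   [y n]. *)
exists n.+1 => // m /= nm; rewrite /series/= big_mkord (bigD1 (Ordinal nm))//=.
rewrite eqxx mul1r big1 ?addr0// => k; rewrite -val_eqE/= => /negbTE ->.
by rewrite mul0r.
Qed.

End lp.

Theorem proposition2p12 (R : realType) (p : R) (p1 : 1 <= p) (p2 : p <= 2) :
  unconditional_HS_basis (unit_vector p1) (coordinate_functional p1).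
Proof.
split; last exact: unit_vector_unconditional.
split.
- exact: schauder_basis_separable (unit_vector_schauder p1).
- exact: unit_vector_schauder.
- by [].
- exists (lp_to_dual p1 p2).
    exact: lp_to_dual_bounded.
  exact: lp_to_dual_unit_vector.
Qed.
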